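(* Let $\mathcal{H}$ be a class of finite hypergraphs (all hyperedges having size at least $2$) and let $q$ be a polynomial such that, for every $G=(V,E)\in\mathcal{H}$, there exists a vertex order $\sigma$ of $V$ satisfying $W(\sigma)\le q(|V|,|E|)$. Then, for every $G=(V,E)\in\mathcal{H}$ and such an order $\sigma$, the compact decision diagram for $G$ under $\sigma$ has polynomial size (its number of nodes and arcs is bounded by a polynomial in $|V|$ and $|E|$ depending only on $q$). Moreover, if $q(|V|,|E|)$ is a constant, then the compact decision diagram has $O(|V|)$ nodes and arcs.
   Context: A hypergraph $G=(V,E)$ has finite vertex set $V$ and a set $E$ of hyperedges $e\subseteq V$ with $|e|\ge2$. Fix a vertex order $\sigma=(v_1,\ldots,v_n)$, $n=|V|$. Put $U_0=\emptyset$ and $U_i=\{v_1,\ldots,v_i\}$. The set of active hyperedges at $i\in\{0,\ldots,n\}$ is $\mathcal{A}_i=\{e\in E: e\cap U_i\ne\emptyset,\ e\nsubseteq U_i\}$. Compact decision diagram (DD). Each vertex $v_i$ has a binary variable $z_{v_i}\in\{0,1\}$. States are subsets of active hyperedges. The initial state is $s_0=\emptyset$, and assigning $z_{v_i}$ in state $s_{i-1}\subseteq\mathcal{A}_{i-1}$ leads to the state $$\phi_i(s_{i-1},z_{v_i})=\{e\in\mathcal{A}_i:\ (e\notin\mathcal{A}_{i-1}\text{ or }e\in s_{i-1})\text{ and }(v_i\notin e\text{ or }z_{v_i}=1)\}.$$ The compact DD of $G$ under $\sigma$ is the layered directed acyclic (multi)graph with layers $1,\ldots,n+1$ whose nodes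 in layer $i+1$ ($0\le i\le n$) are the distinct states $s_i$ reachable from $s_0$ by some assignment of $z_{v_1},\ldots,z_{v_i}$ (nodes with equal states are merged). Each node $s_{i-1}$ in layer $i\le n$ has exactly two outgoing arcs, one for each value $z_{v_i}\in\{0,1\}$, going to the node $\phi_i(s_{i-1},z_{v_i})$ of layer $i+1$. Its size is its number of nodes and arcs. Valid antichains. For $e\in\mathcal{A}_i$ let $\rho_i(e)=e\cap U_i$, and let $\mathcal{R}_i=\{\rho_i(e):e\in\mathcal{A}_i\}$ be partially ordered by inclusion. An antichain $\mathcal{C}\subseteq\mathcal{R}_i$ is a (possibly empty) set of pairwise incomparable elements; with $X(\mathcal{C})=\bigcup_{R\in\mathcal{C}}R$, it is valid if for every $R\in\mathcal{R}_i$ with $R\subseteq X(\mathcal{C})$ there exists $M\in\mathcal{C}$ with $R\subseteq M$. Let $\operatorname{VA}_i(\sigma)$ be the set of valid antichains of $(\mathcal{R}_i,\subseteq)$ under the order $\sigma$, and $W(\sigma)=\max_{i}|\operatorname{VA}_i(\sigma)|$, the maximum being over $i\in\{0,\ldots,n\}$. *)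

(* Defs.v *)
From HB Require Import structures.
From mathcomp Require Import all_boot all_order all_algebra.
Set Implicit Arguments.
Unset Strict Implicit.
Unset Printing Implicit Defensive.

Record hypergraph := Hypergraph {
  vertex : finType;
  edges : {set {set vertex}};
  edges_ge2 : forall e, e \in edges -> 2 <= #|e| }.

Record vertex_order (G : hypergraph) := VertexOrder {
  order_seq :> #|vertex G|.-tuple (vertex G);
  order_uniq : uniq order_seq }.

(* The underlying directed multigraph of a decision diagram. *)
Record multigraph := Multigraph {
  node : finType;
  arc : finType;
  source : arc -> node;
  target : arc -> node }.

Definition multigraph_size (D : multigraph) : nat := #|node D| + #|arc D|.

Section Order.
Variables (G : hypergraph) (sigma : vertex_order G).
Local Notation n := #|vertex G|.

Definition prefix_set (i : nat) : {set vertex G} := [set v in take i sigma].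

Definition active (i : nat) : {set {set vertex G}} :=
  [set e in edges G |
    (e :&: prefix_set i != set0) && ~~ (e \subset prefix_set i)].

(* For k : 'I_n, the vertex [tnth sigma k] is v_(k+1), so [transition k] is
   phi_(k+1), leading from states at k to states at k+1. *)
Definition transition (k : 'I_n) (s : {set {set vertex G}}) (z : bool) :
    {set {set vertex G}} :=
  [set e in active k.+1 |
    ((e \notin active k) || (e \in s)) && ((tnth sigma k \notin e) || z)].

(* The states reachable after i assignments, i.e. the nodes of layer i+1 of the
   diagram; the [None] branch only occurs for i > n. *)
Fixpoint reachable (i : nat) : {set {set {set vertex G}}} :=
  if i is j.+1 then
    if insub j is Some k
    then [set transition k s z | s in reachable j, z in [set: bool]]
    else set0
  else [set set0].

Lemma reachable_transition (k : 'I_n) s z :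
  s \in reachable k -> transition k s z \in reachable k.+1.
Proof.
move=> sk; rewrite /= insubT // => lt_kn.
have -> : Sub (nat_of_ord k) lt_kn = k by apply: val_inj.
by apply/imset2P; exists s z; rewrite ?inE.
Qed.

(* A node is a layer index together with a state reachable at that layer:
   equal states are merged within a layer, not across layers. *)
Definition dd_node : finType :=
  {x : 'I_n.+1 * {set {set vertex G}} | x.2 \in reachable x.1}.

(* An arc is a node outside the last layer together with a value of its
   variable; the two arcs leaving a node are distinct even if parallel. *)
Definition dd_arc : finType :=
  ({x : 'I_n * {set {set vertex G}} | x.2 \in reachable x.1} * bool)%type.

Definition dd_source (a : dd_arc) : dd_node :=
  exist (fun x : 'I_n.+1 * {set {set vertex G}} => x.2 \in reachable x.1)
    (widen_ord (leqnSn n) (val a.1).1, (val a.1).2) (valP a.1).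

Definition dd_target (a : dd_arc) : dd_node :=
  exist (fun x : 'I_n.+1 * {set {set vertex G}} => x.2 \in reachable x.1)
    (Ordinal (ltn_ord (val a.1).1 : (val a.1).1.+1 < n.+1),
     transition (val a.1).1 (val a.1).2 a.2)
    (reachable_transition a.2 (valP a.1)).

Definition compact_dd : multigraph :=
  @Multigraph dd_node dd_arc dd_source dd_target.

Definition restrictions (i : nat) : {set {set vertex G}} :=
  [set e :&: prefix_set i | e in active i].

Definition antichain (C : {set {set vertex G}}) : bool :=
  [forall R in C, forall S in C, (R \subset S) ==> (R == S)].

Definition valid (i : nat) (C : {set {set vertex G}}) : bool :=
  [forall R in restrictions i,
    (R \subset cover C) ==> [exists M in C, R \subset M]].

Definition valid_antichains (i : nat) : {set {set {set vertex G}}} :=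
  [set C in powerset (restrictions i) | antichain C && valid i C].

Definition width : nat := \max_(i < n.+1) #|valid_antichains i|.

End Order.

(* Main.v *)
Require Import Defs.
From mathcomp Require Import all_boot all_order all_algebra.
Set Implicit Arguments.
Unset Strict Implicit.
Unset Printing Implicit Defensive.
Import Order.TTheory GRing.Theory Num.Theory.

(** The size of the diagram is governed by the number of states per layer, so
the whole proof consists in mapping the valid antichains of level [i] onto the
states reachable after [i] assignments.

An active hyperedge [e] belongs to the state after [i] assignments exactly when
every vertex of [e] processed so far received the value 1.  So, if [T] is the
set of vertices that received 1, the state is the set [surviving i T] of the
active [e] whose restriction [e :&: prefix_set i] lies inside [T]
([reachable_surviving]).  Different [T] may give the same state; the state only
remembers which restrictions fit inside [T].  Those are recorded by the maximal
ones, which form an antichain [C], and [C] is valid: a restriction inside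
[cover C] is inside [T], hence below a maximal one.  Conversely
[surviving i (cover C)] gives the state back, so each state is the image of a
valid antichain under [C |-> surviving i (cover C)]
([reachable_valid_antichain]), and a layer has at most [width sigma] nodes.

With [n] vertices there are [n + 1] layers of nodes, and two arcs leave each
node of the first [n] layers; hence the size is at most [(3 n + 1) W]
([compact_dd_size_le]).  Replacing [W] by [q] gives the polynomial bound, and by
a constant gives the linear one. *)

Section States.
Variables (G : hypergraph) (sigma : vertex_order G).
Local Notation n := #|vertex G|.

(** Here [T] is any set of vertices, not only one of processed vertices: it stands
both for the vertices that received the value 1 and for the cover of a valid
antichain. *)
Definition surviving (i : nat) (T : {set vertex G}) : {set {set vertex G}} :=
  [set e in active sigma i | e :&: prefix_set sigma i \subset T].

Lemma in_surviving (i : nat) (T e : {set vertex G}) :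
  (e \in surviving i T) =
  (e \in active sigma i) && (e :&: prefix_set sigma i \subset T).
Proof. by rewrite {1}/surviving in_set. Qed.

Lemma prefix_setS (k : 'I_n) :
  prefix_set sigma k.+1 = tnth sigma k |: prefix_set sigma k.
Proof.
apply/setP=> v; rewrite !inE (take_nth (tnth sigma k)) ?size_tuple //.
by rewrite mem_rcons in_cons -tnth_nth.
Qed.

Lemma tnth_notin_prefix_set (k : 'I_n) : tnth sigma k \notin prefix_set sigma k.
Proof.
have := take_uniq k.+1 (order_uniq sigma).
rewrite (take_nth (tnth sigma k)) ?size_tuple //.
by rewrite rcons_uniq -tnth_nth inE => /andP[].
Qed.

(** Since the new vertex [v] is outside [prefix_set k], putting it in [T] or
removing it leaves the old restrictions' inclusion in [T] unchanged, and lets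
the part of [e] in [{v}] fit exactly when [v \notin e] or [z]. *)
Lemma transition_surviving (k : 'I_n) (T : {set vertex G}) (z : bool) :
  transition sigma k (surviving k T) z =
  surviving k.+1 (if z then tnth sigma k |: T else T :\ tnth sigma k).
Proof.
have vU := tnth_notin_prefix_set k.
set v := tnth sigma k in vU *; set U := prefix_set sigma k in vU *.
set T' := if z then _ else _.
apply/setP=> e; rewrite /transition /surviving !in_set.
rewrite prefix_setS -/v -/U.
case eE: (e \in edges G) => //=.
case e_act: (_ && ~~ (e \subset v |: U)) => //=.
have eU : ~~ (e \subset U).
  by case/andP: e_act => _; apply: contra => /subset_trans-> //; apply: subsetUr.
rewrite eU andbT /=.
(* A hyperedge missing [U] is inactive at [k], and its empty restriction lies in
   any [T]: the two ways of entering the state merge into one inclusion. *)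
have -> : ~~ (e :&: U != set0) || (e :&: U != set0) && (e :&: U \subset T)
          = (e :&: U \subset T).
  by case: (eqVneq (e :&: U) set0) => [-> | _] //=; rewrite sub0set.
have -> : (e :&: U \subset T) = (e :&: U \subset T').
  (* Only the membership of [v] differs between [T] and [T'], and [v \notin U]. *)
  have TT' x : x \in U -> (x \in T') = (x \in T).
    move=> xU; have /negPf xv : x != v by apply: contraNneq vU => <-.
    by rewrite /T'; case: (z); rewrite !inE xv.
  by apply/subsetP/subsetP => sub x xeU; have:= sub x xeU; rewrite TT' //;
    case/setIP: xeU.
have -> : (v \notin e) || z = (e :&: [set v] \subset T').
  have vT' : (v \in T') = z by rewrite /T'; case: (z); rewrite !inE eqxx.
  rewrite -vT' -implybE; apply/implyP/subsetP => [imp x | sub ve].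
    by case/setIP=> xe /set1P xv; rewrite xv; apply: imp; rewrite -xv.
  by apply: sub; rewrite !inE ve eqxx.
by rewrite setIUr subUset andbC.
Qed.

Lemma reachable_surviving (i : nat) s :
  s \in reachable sigma i -> exists T, s = surviving i T.
Proof.
elim: i s => [|i IHi] s /=.
  rewrite inE => /eqP->; exists set0; apply/setP=> e.
  rewrite /surviving /active !in_set.
  have -> : prefix_set sigma 0 = set0.
    by apply/setP=> v; rewrite !inE take0.
  by rewrite setI0 eqxx andbF.
move: IHi; case: insubP => [k _ <- IHi | _ _]; last by rewrite inE.
by case/imset2P=> [t z /IHi[T ->] _ ->]; rewrite transition_surviving; eexists.
Qed.

(** The antichain attached to the state [surviving i T]. *)
Definition maximal_restrictions (i : nat) (T : {set vertex G}) :
    {set {set vertex G}} :=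
  [set M | maxset [pred M' in restrictions sigma i | M' \subset T] M].

Lemma cover_maximal_restrictions (i : nat) (T : {set vertex G}) :
  cover (maximal_restrictions i T) \subset T.
Proof. by apply/bigcupsP=> M; rewrite inE => /maxsetp/andP[]. Qed.

Lemma sub_maximal_restriction (i : nat) (T M : {set vertex G}) :
  M \in restrictions sigma i -> M \subset T ->
  exists2 M', M' \in maximal_restrictions i T & M \subset M'.
Proof.
move=> Mi MT; have [|M' maxM' MM'] := @maxset_exists _
  [pred M' in restrictions sigma i | M' \subset T] M; first exact/andP.
by exists M'; rewrite ?inE.
Qed.

(** Validity holds because [cover C] stays inside [T]: the restrictions under
[cover C] are then among those that the maximal ones dominate. *)
Lemma valid_antichain_maximal_restrictions (i : nat) (T : {set vertex G}) :
  maximal_restrictions i T \in valid_antichains sigma i.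
Proof.
rewrite inE; apply/and3P; split.
- by rewrite inE; apply/subsetP=> M; rewrite inE => /maxsetp/andP[].
- apply/forall_inP=> M; rewrite inE => maxM; apply/forall_inP=> M'.
  rewrite inE => /maxsetp PM'; apply/implyP => MM'.
  by case/maxsetP: maxM => _ /(_ _ PM' MM')->.
- apply/forall_inP=> M Mi; apply/implyP => MC.
  have [M' M'C MM'] := sub_maximal_restriction Mi
    (subset_trans MC (cover_maximal_restrictions i T)).
  by apply/exists_inP; exists M'.
Qed.

(** Replacing [T] by the smaller [cover C] loses no hyperedge, as a restriction
inside [T] lies in a maximal one, thus in [cover C]. *)
Lemma surviving_cover_maximal_restrictions (i : nat) (T : {set vertex G}) :
  surviving i (cover (maximal_restrictions i T)) = surviving i T.
Proof.
apply/setP=> e; rewrite !in_surviving.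
case e_act: (e \in active sigma i) => //=.
apply/idP/idP=> [sub | eT].
  exact: subset_trans sub (cover_maximal_restrictions i T).
have e_res := imset_f (fun e => e :&: prefix_set sigma i) e_act.
have [M MC eM] := sub_maximal_restriction e_res eT.
exact: subset_trans eM (bigcup_sup (F := id) M MC).
Qed.

Lemma reachable_valid_antichain (i : nat) s :
  s \in reachable sigma i ->
  exists2 C, C \in valid_antichains sigma i & s = surviving i (cover C).
Proof.
case/reachable_surviving=> T ->; exists (maximal_restrictions i T).
  exact: valid_antichain_maximal_restrictions.
by rewrite surviving_cover_maximal_restrictions.
Qed.

Lemma card_reachable_le_width (i : 'I_n.+1) : #|reachable sigma i| <= width sigma.
Proof.
apply: leq_trans (leq_bigmax i).
apply: leq_trans (leq_imset_card (surviving i \o cover) _).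
apply/subset_leq_card/subsetP=> s /reachable_valid_antichain[C VC ->].
exact: imset_f.
Qed.

End States.

Lemma card_sig_fibers (I T : finType) (A : I -> {set T}) :
  #|{: {x : I * T | x.2 \in A x.1}}| = \sum_(i : I) #|A i|.
Proof.
rewrite card_sig -sum1_card; under [RHS]eq_bigr do rewrite -sum1_card.
by rewrite pair_big_dep.
Qed.

Lemma compact_dd_size_le (G : hypergraph) (sigma : vertex_order G) :
  multigraph_size (compact_dd sigma) <= (3 * #|vertex G| + 1) * width sigma.
Proof.
rewrite /multigraph_size /= /dd_node /dd_arc card_prod card_bool.
rewrite (card_sig_fibers (fun i : 'I_#|vertex G|.+1 => reachable sigma i)).
rewrite (card_sig_fibers (fun i : 'I_#|vertex G| => reachable sigma i)).
have nodes : \sum_(i < #|vertex G|.+1) #|reachable sigma i|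
             <= #|vertex G|.+1 * width sigma.
  rewrite -[X in X * _]card_ord -sum_nat_const.
  by apply: leq_sum => i _; apply: card_reachable_le_width.
have arcs : \sum_(i < #|vertex G|) #|reachable sigma i|
            <= #|vertex G| * width sigma.
  rewrite -[X in X * _]card_ord -sum_nat_const.
  apply: leq_sum => i _.
  exact: (card_reachable_le_width sigma (widen_ord (leqnSn _) i)).
apply: leq_trans (leq_add nodes (leq_mul arcs (leqnn 2))) _.
by rewrite mulnAC -mulnDl leq_mul2r mulnC -addn1 addnAC -mulSn leqnn orbT.
Qed.

Local Open Scope ring_scope.

Theorem theorem1 (R : archiRealDomainType) (q : {poly {poly R}}) :
  (exists p : {poly {poly R}},
    forall H : hypergraph -> Prop,
    (forall G : hypergraph, H G -> exists sigma : vertex_order G,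
       (width sigma)%:R <= q.[#|vertex G|%:R, #|edges G|%:R]) ->
    forall G : hypergraph, H G -> forall sigma : vertex_order G,
    (width sigma)%:R <= q.[#|vertex G|%:R, #|edges G|%:R] ->
    (multigraph_size (compact_dd sigma))%:R
      <= p.[#|vertex G|%:R, #|edges G|%:R])
  /\
  (forall c : R, exists C : nat,
    forall H : hypergraph -> Prop,
    (forall G : hypergraph, H G -> exists sigma : vertex_order G,
       (width sigma)%:R <= q.[#|vertex G|%:R, #|edges G|%:R]) ->
    (forall G : hypergraph, H G ->
       q.[#|vertex G|%:R, #|edges G|%:R] = c) ->
    forall G : hypergraph, H G -> (0 < #|vertex G|)%N ->
    forall sigma : vertex_order G,
    (width sigma)%:R <= q.[#|vertex G|%:R, #|edges G|%:R] ->
    (multigraph_size (compact_dd sigma) <= C * #|vertex G|)%N).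
Proof.
split=> [|c].
  exists (('X *+ 3 + 1) * q) => H _ G _ sigma Wq.
  have -> : (('X *+ 3 + 1) * q).[#|vertex G|%:R, #|edges G|%:R]
            = (3 * #|vertex G| + 1)%:R * q.[#|vertex G|%:R, #|edges G|%:R].
    rewrite natrD natrM mulr_natl.
    by rewrite !(hornerM, hornerD, hornerMn, hornerX, hornerC).
  apply: le_trans (ler_wpM2l (ler0n _ _) Wq).
  by rewrite -natrM ler_nat compact_dd_size_le.
exists (4 * Num.truncn c)%N => H _ qc G HG n_gt0 sigma.
rewrite qc // => Wc.
have Wt : (width sigma <= Num.truncn c)%N.
  by rewrite truncn_ge_nat // (le_trans (ler0n _ _) Wc).
apply: leq_trans (compact_dd_size_le sigma) _.
rewrite mulnAC leq_mul // -[4%N]/(3 + 1)%N mulnDl leq_add2l mul1n.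
exact: n_gt0.
Qed.
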